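(* Let $K \subset \mathbb{R}^d$ be a convex, centrally symmetric set with nonempty interior. Let $v_1,\dots,v_n \in \mathbb{R}^d$ be fixed vectors, and let $\varepsilon_1,\ldots,\varepsilon_n$ be independent Rademacher random variables. Let $\pi$ be a smooth probability density on $\mathbb{R}^d$ whose support is contained in the interior of $K$. Then there exists an online algorithm that discards some of the steps $\varepsilon_j v_j$ (and accepts the others) such that, for each $k \in \{1,\dots,n\}$, $$\sum_{j \le k,\ j \text{ accepted}} \varepsilon_j v_j \in 2K \quad \text{deterministically},$$ and $$\mathbb{E}\,\#\{\text{discarded}\} \le \frac{1}{2} \sum_{j=1}^n \sqrt{v_j^{\mathsf T} \mathcal{I}_\pi v_j},$$ where $\mathcal{I}_\pi$ is the Fisher information matrix of the family of translates of $\pi$, evaluated at the origin.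
   Context: A Rademacher random variable takes the values $+1$ and $-1$ with probability $1/2$ each. For a set $K$, $2K = \{2x : x \in K\}$; centrally symmetric means $K=-K$. Fisher information matrix: $\mathcal{I}_\pi = \mathbb{E}\big[(\nabla \log \pi(X))(\nabla \log \pi(X))^{\mathsf T}\big]$ where $X$ has density $\pi$ (the expectation is an integral over $\{\pi>0\}$). Thus $v^{\mathsf T}\mathcal{I}_\pi v = \mathbb{E}\langle \nabla\log\pi(X), v\rangle^2 \in [0,\infty]$; if this is $+\infty$ for some $v_j$, the bound is trivially true. Online algorithm: the steps $\varepsilon_1 v_1, \varepsilon_2 v_2,\dots$ are revealed one at a time. Upon observing step $\varepsilon_j v_j$, the algorithm must immediately decide whether to accept or discard it; the decision may depend on the steps observed so far (and on internal randomness of the algorithm independent of the signs), but not on future steps, and it cannot be changed later. ''Deterministically'' means for every realization of the signs and of the internal randomness. The expectation is over the signs and the internal randomness, and $\#\{\text{discarded}\}$ is the number of indices $j\in\{1,\dots,n\}$ whose step is discarded. *)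

(* Defs.v *)
From HB Require Import structures.
From mathcomp Require Import all_boot all_order all_algebra.
From mathcomp Require Import all_classical all_reals all_analysis.
From mathcomp Require Import ring.

Set Implicit Arguments.
Unset Strict Implicit.
Unset Printing Implicit Defensive.

Import Order.TTheory GRing.Theory Num.Theory.
Import numFieldNormedType.Exports.

Local Open Scope classical_set_scope.
Local Open Scope ring_scope.

(** R^d is ['rV[R]_d]. It carries the product sigma-algebra, generated by the
    coordinates. *)

Definition rV_display (d : measure_display) : measure_display.
Proof. exact d. Qed.

Section rV_measurable.
Context {disp : measure_display} {T : measurableType disp}.
Variable d : nat.

Let coord (i : 'I_d) (x : 'rV[T]_d) : T := x ord0 i.

Let rV_set0 : g_sigma_preimage coord set0.
Proof. exact: sigma_algebra0. Qed.

Let rV_setC A : g_sigma_preimage coord A -> g_sigma_preimage coord (~` A).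
Proof. exact: sigma_algebraC. Qed.

Let rV_bigcup (F : (set 'rV[T]_d)^nat) :
  (forall i, g_sigma_preimage coord (F i)) ->
  g_sigma_preimage coord (\bigcup_i (F i)).
Proof. exact: sigma_algebra_bigcup. Qed.

HB.instance Definition _ := @isMeasurable.Build (rV_display disp)
  'rV[T]_d (g_sigma_preimage coord) rV_set0 rV_setC rV_bigcup.

Lemma measurable_rV_coord (i : 'I_d) :
  measurable_fun [set: 'rV[T]_d] (fun x => x ord0 i).
Proof.
move=> _ Y mY; rewrite setTI; apply: sub_sigma_algebra => /=.
rewrite -bigcup_seq/=; exists i => /=; first by rewrite mem_index_enum.
by exists Y => //; rewrite setTI.
Qed.

Lemma measurable_fun_rV (d1 : measure_display) (T1 : measurableType d1)
    (f : T1 -> 'rV[T]_d) :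
  (forall i, measurable_fun setT (fun t => f t ord0 i)) ->
  measurable_fun setT f.
Proof.
move=> mf _ A mA.
have sub : g_sigma_preimage coord `<=` image_set_system setT f measurable.
  apply: smallest_sub.
    exact/sigma_algebra_image/sigma_algebra_measurable.
  move=> B; rewrite -bigcup_seq => -[i _ [C mC <-]].
  by rewrite /image_set_system/= !setTI -(setTI (_ @^-1` _)); exact: mf.
exact: sub mA.
Qed.

End rV_measurable.

Section lebesgue_rV.
Context {R : realType}.

Definition rV_cons d (p : R * 'rV[R]_d) : 'rV[R]_d.+1 :=
  row_mx (p.1%:M : 'rV[R]_1) p.2.

Lemma rV_cons0 d (p : R * 'rV[R]_d) : rV_cons p ord0 ord0 = p.1.
Proof.
have -> : ord0 = lshift d (ord0 : 'I_1) by exact/val_inj.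
by rewrite /rV_cons (row_mxEl (p.1%:M : 'rV_1)) mxE eqxx mulr1n.
Qed.

Lemma rV_consS d (p : R * 'rV[R]_d) (i : 'I_d) :
  rV_cons p ord0 (lift ord0 i) = p.2 ord0 i.
Proof.
have -> : lift ord0 i = rshift 1 i by exact/val_inj.
by rewrite /rV_cons (row_mxEr (p.1%:M : 'rV_1)).
Qed.

Lemma measurable_rV_cons d : measurable_fun setT (@rV_cons d).
Proof.
apply: measurable_fun_rV => i; case: (unliftP ord0 i) => [j|] ->.
- rewrite [X in measurable_fun _ X](_ : _ = (fun x : 'rV[R]_d => x ord0 j) \o snd).
    exact: measurableT_comp (measurable_rV_coord j) measurable_snd.
  by apply/funext => p /=; rewrite rV_consS.
- rewrite [X in measurable_fun _ X](_ : _ = fst) //.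
  by apply/funext => p; rewrite rV_cons0.
Qed.

Definition rV_uncons d (x : 'rV[R]_d.+1) : R * 'rV[R]_d :=
  (x ord0 ord0, \row_i x ord0 (lift ord0 i)).

Lemma rV_consK d : cancel (@rV_cons d) (@rV_uncons d).
Proof.
move=> [a x]; rewrite /rV_uncons rV_cons0; congr pair.
by apply/rowP => i; rewrite mxE rV_consS.
Qed.

Lemma measurable_rV_uncons d : measurable_fun setT (@rV_uncons d).
Proof.
apply: measurable_fun_pair; first exact: measurable_rV_coord.
apply: measurable_fun_rV => i.
under eq_fun do rewrite mxE.
exact: measurable_rV_coord.
Qed.

Section lebesgue_rV_step.
Variables (d : nat) (m : {sigma_finite_measure set 'rV[R]_d -> \bar R}).

Definition lebesgue_rV_step : set 'rV[R]_d.+1 -> \bar R :=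
  pushforward (@lebesgue_measure R \x m)%E (@rV_cons d).

Let step0 : lebesgue_rV_step set0 = 0%E.
Proof. by rewrite /lebesgue_rV_step /pushforward preimage_set0 measure0. Qed.

Let step_ge0 A : (0 <= lebesgue_rV_step A)%E.
Proof. by rewrite /lebesgue_rV_step /pushforward. Qed.

Let step_sigma_additive : semi_sigma_additive lebesgue_rV_step.
Proof.
move=> F mF tF mUF; rewrite /lebesgue_rV_step /pushforward preimage_bigcup.
apply: measure_semi_sigma_additive.
- by move=> n; rewrite -[X in measurable X]setTI; exact: measurable_rV_cons.
- apply/trivIsetP => /= i j _ _ ij; rewrite -preimage_setI.
  by move/trivIsetP : tF => /(_ _ _ _ _ ij) ->//; rewrite preimage_set0.
- rewrite -preimage_bigcup -[X in measurable X]setTI.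
  exact: measurable_rV_cons.
Qed.

HB.instance Definition _ := isMeasure.Build _ _ _ lebesgue_rV_step
  step0 step_ge0 step_sigma_additive.

Let step_sigma_finite : sigma_finite setT lebesgue_rV_step.
Proof.
have /sigma_finiteP[F [TF ndF Foo]] := sigma_finiteT (@lebesgue_measure R).
have /sigma_finiteP[G [TG ndG Goo]] := sigma_finiteT m.
exists (fun n => @rV_uncons d @^-1` (F n `*` G n)).
  rewrite -preimage_bigcup (_ : \bigcup_n _ = setT) ?preimage_setT//.
  rewrite -setXTT TF TG predeqE => -[x y]; split=> [|xy].
    by move=> [n _ []/= ? ?]; split; exists n.
  move: xy => [/= [n _ Fnx] [k _ Gky]]; exists (maxn n k) => //; split.
  - by move: x Fnx; exact/subsetPset/ndF/leq_maxl.
  - by move: y Gky; exact/subsetPset/ndG/leq_maxr.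
move=> n; have [mF Fn] := Foo n; have [mG Gn] := Goo n; split.
  rewrite -[X in measurable X]setTI; apply: measurable_rV_uncons => //.
  exact: measurableX.
rewrite /lebesgue_rV_step /pushforward -comp_preimage.
rewrite (_ : _ \o _ = id) ?preimage_id; last exact/funext/rV_consK.
by rewrite product_measure1E// lte_mul_pinfty// ge0_fin_numE.
Qed.

HB.instance Definition _ := Measure_isSigmaFinite.Build _ _ _
  lebesgue_rV_step step_sigma_finite.

End lebesgue_rV_step.

Fixpoint lebesgue_rV d : {sigma_finite_measure set 'rV[R]_d -> \bar R} :=
  match d with
  | 0 => \d_(0 : 'rV[R]_0)
  | d'.+1 => lebesgue_rV_step (lebesgue_rV d')
  end.

Lemma measurable_rV_box d (A : 'I_d -> set R) :
  (forall i, measurable (A i)) ->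
  measurable [set x : 'rV[R]_d | forall i, A i (x ord0 i)].
Proof.
move=> mA; rewrite (_ : mkset _ =
    \big[setI/setT]_(i < d) ((fun x : 'rV[R]_d => x ord0 i) @^-1` A i)).
  apply: bigsetI_measurable => i _; rewrite -[X in measurable X]setTI.
  exact: measurable_rV_coord.
rewrite -bigcap_seq; apply/seteqP; split => [x Ax i _|x Ax i]; first exact: Ax.
by apply: Ax => /=; rewrite mem_index_enum.
Qed.

Lemma lebesgue_rV_box d (A : 'I_d -> set R) :
  (forall i, measurable (A i)) ->
  lebesgue_rV d [set x : 'rV[R]_d | forall i, A i (x ord0 i)] =
  (\prod_(i < d) @lebesgue_measure R (A i))%E.
Proof.
elim: d A => [|d IH] A mA.
  by rewrite big_ord0 /= diracE mem_set// => -[].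
rewrite big_ord_recl -IH//= /lebesgue_rV_step /pushforward.
rewrite -product_measure1E; first last.
- exact: (measurable_rV_box (A := fun i => A (lift ord0 i))).
- exact: mA.
congr ((_ \x _)%E _); apply/seteqP; split => [p /= Ap|p [A0 AS] i /=].
  split; first by have := Ap ord0; rewrite rV_cons0.
  by move=> i; have := Ap (lift ord0 i); rewrite rV_consS.
by case: (unliftP ord0 i) => [j|] ->; rewrite ?rV_consS ?rV_cons0//; exact: AS.
Qed.

End lebesgue_rV.

Section density.
Context {R : realType} {d : nat}.
Implicit Types (f rho : 'rV[R]_d -> R) (x v : 'rV[R]_d).

(** C^infinity: every iterated directional derivative is differentiable. *)
Definition smooth f :=
  forall (vs : seq 'rV[R]_d) x,
    differentiable (foldr (fun v g => 'D_v g) f vs) x.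

Definition probability_density rho :=
  (forall x, 0 <= rho x) /\ (\int[lebesgue_rV d]_x (rho x)%:E = 1)%E.

Definition closed_support f : set 'rV[R]_d := closure [set x | f x != 0].

Definition gradient f x : 'rV[R]_d := \row_i 'D_(delta_mx 0 i) f x.

Definition dot (u v : 'rV[R]_d) : R := (u *m v^T) 0 0.

Definition score rho : 'rV[R]_d -> 'rV[R]_d := gradient (fun x => ln (rho x)).

(** [fisher rho v] is v^T I_rho v = E <grad log rho (X), v>^2 for X of density
    rho. It takes values in [0, +oo], so that it makes sense even when the
    entries of the matrix I_rho are not all defined; when they are,
    [fisher_matrixE] says that it is the quadratic form of [fisher_matrix]. *)
Definition fisher rho v : \bar R :=
  (\int[lebesgue_rV d]_(x in [set x | (0 < rho x)%R])
     (dot (score rho x) v ^+ 2 * rho x)%:E)%E.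

Definition fisher_matrix rho : 'M[R]_d :=
  \matrix_(i, j) \int[lebesgue_rV d]_(x in [set x | 0 < rho x])
    (((score rho x)^T *m score rho x) i j * rho x).

Lemma fisher_matrixE rho v :
  measurable [set x | 0 < rho x] ->
  (forall i j, (lebesgue_rV d).-integrable [set x | 0 < rho x]
     (fun x => (((score rho x)^T *m score rho x) i j * rho x)%:E)) ->
  fisher rho v = ((v *m fisher_matrix rho *m v^T) 0 0)%:E.
Proof.
move=> mD intI; rewrite /fisher.
pose F i j x := ((score rho x)^T *m score rho x) i j * rho x.
transitivity (\int[lebesgue_rV d]_(x in [set x | (0 < rho x)%R])
    \sum_(i < d) \sum_(j < d) ((v 0 i * v 0 j)%:E * (F j i x)%:E))%E.
  apply: eq_integral => x _.
  under eq_bigr do under eq_bigr do rewrite -EFinM.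
  under eq_bigr do rewrite sumEFin.
  rewrite sumEFin /dot mxE expr2 !big_distrl/=; congr EFin.
  apply: eq_bigr => i _; rewrite !big_distrr/= big_distrl/=.
  apply: eq_bigr => j _; rewrite /F !mxE big_ord1 !mxE; ring.
rewrite integral_sum//=; last first.
  move=> i; apply: integrable_sum => // j _.
  by apply: integrableZl => //; exact: intI.
rewrite mxE -sumEFin; apply: eq_bigr => i _.
rewrite integral_sum//=; last by move=> j; apply: integrableZl => //; exact: intI.
rewrite !mxE big_distrl/= -sumEFin; apply: eq_bigr => j _.
rewrite integralZl//; last exact: intI.
rewrite [X in (_ * X * _)%R]mxE /Rintegral mulrAC [v 0 j * _]mulrC !EFinM fineK//.
by apply: integrable_fin_num => //; exact: intI.
Qed.

End density.

Section random_signs.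
Context {disp : measure_display} {Omega : measurableType disp} {R : realType}.
Variable P : probability Omega R.

Definition rademacher (X : {RV P >-> R}) :=
  (P (X @^-1` [set 1%R]) = (2^-1)%:E /\ P (X @^-1` [set (-1)%R]) = (2^-1)%:E)%E.

Definition mutually_independent n (X : 'I_n -> {RV P >-> R}) :=
  forall (J : {set 'I_n}) (B : 'I_n -> set R),
    (forall j, measurable (B j)) ->
    P (\bigcap_(j in [set` J]) (X j @^-1` B j)) =
    (\prod_(j in J) P (X j @^-1` B j))%E.

End random_signs.

(** The decision on a step is a function of the internal randomness and of the
    list of the steps revealed so far, whose last entry is the step to be
    decided. *)
Record online_algorithm (R : realType) (d : nat) := OnlineAlgorithm {
  seed_display : measure_display;
  seed : measurableType seed_display;
  seed_law : probability seed R;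
  decide : seed -> seq 'rV[R]_d -> bool;
  measurable_decide : forall obs, measurable [set w | decide w obs]
}.

Section runs.
Context {R : realType} {d n : nat}.
Variables (A : online_algorithm R d) (v : 'I_n -> 'rV[R]_d).
Implicit Types (w : seed A) (s : 'I_n -> R) (j : 'I_n).

Definition steps s : seq 'rV[R]_d := [seq s i *: v i | i <- enum 'I_n].

Definition accepts w s j : bool := decide w (take j.+1 (steps s)).

Definition num_discarded w s : nat := #|[pred j | ~~ accepts w s j]|.

End runs.

(* Main.v *)
From HB Require Import structures.
Require Import Defs.
From mathcomp Require Import all_boot all_order all_algebra.
From mathcomp Require Import all_classical all_reals all_analysis.
From mathcomp Require Import measurable_realfun ring lra.

(** The algorithm is a random walk that stays stationary for the density rho,
    run by slice sampling so that all its randomness is drawn before the first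
    step. Let mu be Lebesgue measure on R^d x R and G the set of the (x, h) with
    0 < h < rho x, so that mu G = 1. The seed is a point (x, h) uniform in G. The
    walk starts at x and keeps h fixed; a step u is accepted from y exactly when
    h < rho (y + u). Then rho > 0 at all positions, so that they are in K, and
    the sum of the accepted steps, a difference of two positions, is in
    K - K = 2K.

    For a single sign the map (y, h) |-> (y + u, h) if the step fits, (y, h)
    otherwise, does not preserve the restriction of mu to G: it doubles some
    regions and empties others. But averaged over the steps u and -u it does
    ([move_stationary]): at a point (y, h) of G, either u brings mass from
    y - u or -u is rejected, never both. As each sign is independent of the
    earlier ones, the state before step j is uniform in G on average over the
    signs ([walk_stationary]). The j-th step is therefore rejected with
    probability half of mu (G \ (G - v)) + mu (G \ (G + v)), v = v_j, which by
    translation invariance is the measure of the symmetric difference of G and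
    its translate, that is the integral of |rho (x + v) - rho x|
    ([rejection_measure]).

    It remains to bound this L1 distance. The fundamental theorem of calculus
    along v, Tonelli and translation invariance bound it by the L1 norm of the
    derivative of rho along v ([L1_increment_le]), which is the expectation of
    the absolute value of the score along v, and the Cauchy-Schwarz inequality
    bounds that by the square root of the Fisher information
    ([L1_derive_le_fisher]). *)

Set Implicit Arguments.
Unset Strict Implicit.
Unset Printing Implicit Defensive.

Import Order.TTheory GRing.Theory Num.Theory.
Import numFieldNormedType.Exports.

Local Open Scope classical_set_scope.
Local Open Scope ring_scope.

(** * Translation invariance and measurability in R^d *)

Section measure_preserving.
Context {d1 d2 : measure_display} {T1 : measurableType d1}
  {T2 : measurableType d2} {R : realType}.
Local Open Scope ereal_scope.

Definition preserves d (T : measurableType d) (m : set T -> \bar R)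
    (f : T -> T) :=
  measurable_fun setT f /\
  forall A, measurable A -> m (f @^-1` A) = m A.

Lemma preserves_integral d (T : measurableType d)
    (m : {measure set T -> \bar R}) (f : T -> T) (F : T -> \bar R) :
  preserves m f -> measurable_fun setT F -> (forall x, 0 <= F x) ->
  \int[m]_x F (f x) = \int[m]_x F x.
Proof.
move=> [mf pf] mF F0.
transitivity (\int[pushforward m f]_x F x).
  by rewrite ge0_integral_pushforward.
by apply: eq_measure_integral => A mA _; rewrite /pushforward -pf.
Qed.

Variables (m1 : {sigma_finite_measure set T1 -> \bar R})
  (m2 : {sigma_finite_measure set T2 -> \bar R}).

Lemma preserves_product f g : preserves m1 f -> preserves m2 g ->
  preserves (m1 \x m2) (fun p => (f p.1, g p.2)).
Proof.
move=> pf pg; have [mf _] := pf; have [mg Hg] := pg; split.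
  apply: measurable_fun_pair.
    exact: measurableT_comp mf measurable_fst.
  exact: measurableT_comp mg measurable_snd.
move=> A mA; rewrite /product_measure1.
rewrite -[RHS](preserves_integral pf)//=; last exact: measurable_fun_xsection.
apply: eq_integral => x _ /=.
rewrite -[RHS]Hg; last exact: measurable_xsection.
by congr (m2 _); apply/seteqP; split => y; rewrite /xsection/= !inE.
Qed.

End measure_preserving.

(** Lebesgue measure is determined by its values on the intervals ]u, v], and
    a translation carries these to intervals of the same length. *)
Lemma preserves_lebesgue {R : realType} (a : R) :
  preserves (@lebesgue_measure R) (fun x => x + a).
Proof.
pose f : R -> R := fun x => x + a.
have mf : @measurable_fun _ _ (measurableTypeR R) (measurableTypeR R) setT f.
  exact: measurable_funD.
split => // A mA; apply/esym.
pose m : {measure set (measurableTypeR R) -> \bar R} :=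
  measure_function_pushforward__canonical__measure_function_Measure
    (@lebesgue_measure R) mf.
rewrite -[RHS]/(m A).
apply: (@lebesgue_measure_unique _ m) => // X [[u v] /= _ <-].
rewrite /pushforward lebesgue_measure_itv/=.
rewrite (_ : f @^-1` _ = `]u - a, v - a]%classic); last first.
  by apply/seteqP; split => x /=; rewrite !in_itv/= /f ltrBlDr lerBrDr.
rewrite lebesgue_measure_itv/= !lte_fin ltrD2r; case: ifP => // _.
by rewrite -!EFinB; congr (_%:E); ring.
Qed.

Section translations_rV.
Context {R : realType}.

Lemma measurable_rV_addr d (u : 'rV[R]_d) :
  measurable_fun [set: 'rV[R]_d] (fun x => x + u).
Proof.
apply: measurable_fun_rV => i; under eq_fun do rewrite mxE.
by apply: measurable_funD => //; exact: measurable_rV_coord.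
Qed.

Lemma preserves_lebesgue_rV d (u : 'rV[R]_d) :
  preserves (lebesgue_rV d) (fun x : 'rV[R]_d => x + u).
Proof.
split; first exact: measurable_rV_addr.
elim: d u => [|d IH] u A mA.
  by congr (_ _); apply/seteqP; split => x /=; rewrite thinmx0 [x]thinmx0.
rewrite /= /lebesgue_rV_step /pushforward.
pose u' : 'rV[R]_d := \row_i u ord0 (lift ord0 i).
have pS : preserves (lebesgue_rV d) (fun x : 'rV[R]_d => x + u').
  by split; [exact: measurable_rV_addr|exact: IH].
have pp := preserves_product (preserves_lebesgue (u ord0 ord0)) pS.
rewrite -[RHS](pp.2); last first.
  by rewrite -[X in measurable X]setTI; exact: measurable_rV_cons.
congr (_ _); apply/seteqP; split => p /=;
  rewrite (_ : rV_cons _ + u = rV_cons (p.1 + u ord0 ord0, p.2 + u'))//;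
  apply/rowP => i; rewrite [LHS]mxE; case: (unliftP ord0 i) => [j|] ->;
  by rewrite ?rV_consS ?rV_cons0/= ?mxE.
Qed.

(** The sigma-algebra is generated by the coordinates, so this is not immediate
    from the topology. The function f is the pointwise limit of its compositions
    with the rounding to the grid of mesh 1 / (k + 1); such a composition is
    constant on each of countably many half-open cubes, which are boxes. *)
Lemma continuous_measurable_rV d (f : 'rV[R]_d -> R) :
  continuous f -> measurable_fun setT f.
Proof.
move=> cf.
pose r (k : nat) (x : 'rV[R]_d) : 'rV[R]_d :=
  \row_i ((Num.floor (k.+1%:R * x ord0 i))%:~R / k.+1%:R).
apply: (measurable_fun_cvg (h := fun k x => f (r k x))).
- move=> k _ B mB; rewrite setTI.
  pose cell (z : 'rV[int]_d) : set 'rV[R]_d :=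
    [set x | forall i, (Num.floor (k.+1%:R * x ord0 i)) = z ord0 i].
  rewrite (_ : _ @^-1` B = \bigcup_z (cell z `&` [set _ |
      B (f (\row_i ((z ord0 i)%:~R / k.+1%:R)))])); last first.
    apply/seteqP; split => x /=.
      move=> Bx; exists (\row_i Num.floor (k.+1%:R * x ord0 i)) => //=; split.
        by move=> i; rewrite mxE.
      rewrite (_ : (\row_i _) = r k x)//.
      by apply/rowP => i; rewrite !mxE.
    move=> [z _ /= [zx Bz]].
    rewrite (_ : r k x = \row_i ((z ord0 i)%:~R / k.+1%:R))//.
    by apply/rowP => i; rewrite !mxE zx.
  apply: countable_bigcupT_measurable => // z.
  apply: measurableI; last first.
    have [Bz|nBz] := pselect (B (f (\row_i ((z ord0 i)%:~R / k.+1%:R)))).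
      by rewrite (_ : [set _ | _] = setT)//; apply/seteqP; split.
    by rewrite (_ : [set _ | _] = set0)//; apply/seteqP; split.
  apply: (measurable_rV_box
    (A := fun i => [set t | Num.floor (k.+1%:R * t) = z ord0 i])) => i.
  rewrite (_ : [set t | _] =
    `[(z ord0 i)%:~R / k.+1%:R, (z ord0 i + 1)%:~R / k.+1%:R[%classic)//.
  apply/seteqP; split => t /=; rewrite in_itv/= ler_pdivrMr// ltr_pdivlMr// mulrC.
    by move=> <-; rewrite floor_le/= floorD1_gt.
  by move=> h; apply: floor_def.
- move=> x _; apply: continuous_cvg; first exact: cf.
  apply/cvgrPdist_le => /= e e0.
  near=> k.
  rewrite [leLHS]/Num.norm/= mx_normrE; apply: bigmax_le; first exact: ltW.
  move=> [i j] _; rewrite !mxE /=.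
  have -> : i = ord0 by exact: ord1.
  set y := x ord0 j.
  have -> : y - (Num.floor (k.+1%:R * y))%:~R / k.+1%:R =
    (k.+1%:R * y - (Num.floor (k.+1%:R * y))%:~R) / k.+1%:R.
    by field; rewrite nat1r pnatr_eq0.
  have h1 := floor_le (k.+1%:R * y); have h2 := floorD1_gt (k.+1%:R * y).
  rewrite intrD in h2.
  rewrite ger0_norm; last by rewrite divr_ge0// subr_ge0.
  rewrite ler_pdivrMr//; apply: (@le_trans _ _ 1); first lra.
  rewrite -ler_pdivrMl//.
  rewrite mulr1; apply: (@le_trans _ _ k%:R); last by rewrite ler_nat.
  by near: k; exact: nbhs_infty_ger.
Unshelve. all: by end_near. Qed.
End translations_rV.

(** * The L1 modulus of continuity of a density and its Fisher information *)

(** It follows from 2 |a| <= a ^ 2 / k + k, integrated against r and then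
    optimized over k > 0; this asks for no integrability of a. *)
Lemma cauchy_schwarz_weight {R : realType} (disp : measure_display)
    (T : measurableType disp) (mu : {measure set T -> \bar R}) (D : set T)
    (a r : T -> R) :
  measurable D -> measurable_fun D a -> measurable_fun D r ->
  (forall x, D x -> 0 <= r x) -> (\int[mu]_(x in D) (r x)%:E <= 1)%E ->
  (\int[mu]_(x in D) (`|a x| * r x)%:E <=
   sqrte (\int[mu]_(x in D) (a x ^+ 2 * r x)%:E))%E.
Proof.
move=> mD ma mr r0 r1.
have ma2 : measurable_fun D (fun x => (a x ^+ 2 * r x)%:E).
  apply/measurable_EFinP/measurable_funM => //; exact: measurable_funX.
have mar : measurable_fun D (fun x => (`|a x| * r x)%:E).
  by apply/measurable_EFinP/measurable_funM => //; exact: measurableT_comp.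
set I := (\int[mu]_(x in D) (a x ^+ 2 * r x)%:E)%E.
have I0 : (0 <= I)%E.
  by apply: integral_ge0 => x Dx; rewrite lee_fin mulr_ge0 ?sqr_ge0 ?r0.
have weighted k : 0 < k ->
    (\int[mu]_(x in D) (`|a x| * r x)%:E <= (k^-1 / 2)%:E * I + (k / 2)%:E)%E.
  move=> k0.
  have k2 : (0 <= (k / 2)%:E)%E by rewrite lee_fin divr_ge0// ltW.
  have k3 : (0 <= (k^-1 / 2)%:E)%E by rewrite lee_fin divr_ge0// invr_ge0 ltW.
  apply: (@le_trans _ _ (\int[mu]_(x in D)
      ((k^-1 / 2)%:E * (a x ^+ 2 * r x)%:E + (k / 2)%:E * (r x)%:E))%E).
    apply: ge0_le_integral => //.
    - by move=> x Dx; rewrite lee_fin mulr_ge0 ?r0.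
    - apply: emeasurable_funD; apply: measurable_funeM => //.
      exact/measurable_EFinP.
    - move=> x Dx; rewrite -!EFinM -EFinD lee_fin.
      rewrite mulrA -mulrDl; apply: ler_wpM2r; first exact: r0.
      rewrite -real_normK ?num_real//; set b := `|a x|.
      rewrite -(ler_pM2l (x := 2 * k)) ?mulr_gt0//.
      rewrite [leRHS](_ : _ = b ^+ 2 + k ^+ 2); last by field; rewrite gt_eqF.
      have : 0 <= (b - k) ^+ 2 by exact: sqr_ge0.
      by nra.
  rewrite ge0_integralD//=; last 4 first.
  - by move=> x Dx; apply: mule_ge0 => //; rewrite lee_fin mulr_ge0 ?sqr_ge0 ?r0.
  - exact: measurable_funeM.
  - by move=> x Dx; apply: mule_ge0 => //; rewrite lee_fin r0.
  - by apply: measurable_funeM; exact/measurable_EFinP.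
  rewrite ge0_integralZl//; last first.
    by move=> x Dx; rewrite lee_fin mulr_ge0 ?sqr_ge0 ?r0.
  apply: leeD => //; rewrite ge0_integralZl//; last exact/measurable_EFinP.
  by rewrite -[leRHS]mule1; apply: lee_wpmul2l.
case: I I0 weighted => [c|_ _|//]; last exact: leey.
rewrite lee_fin => c0 w /=.
(* The optimal k is the square root of the integral; adding e keeps it positive
   when the integral vanishes. *)
apply/lee_addgt0Pr => e e0.
have s0 : 0 <= Num.sqrt c by exact: sqrtr_ge0.
have k0 : 0 < Num.sqrt c + e by rewrite ltr_wpDl.
apply: le_trans (w _ k0) _.
rewrite -EFinM -!EFinD lee_fin.
have := sqr_sqrtr c0; set s := Num.sqrt c in s0 k0 * => <-.
have : (s + e)^-1 * s ^+ 2 <= s by rewrite ler_pdivrMl// expr2; nra.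
by lra.
Qed.

Section fisher_bound.
Context {R : realType} {d : nat}.
Variable rho : 'rV[R]_d -> R.
Hypothesis drho : forall x, differentiable rho x.

Lemma is_derive_along (x v : 'rV[R]_d) (t : R) :
  is_derive t 1 (fun s => rho (x + s *: v)) ('D_v rho (x + t *: v)).
Proof.
have E : (fun h : R => h^-1 *: (((fun s => rho (x + s *: v)) \o shift t) (h *: 1)
     - rho (x + t *: v))) =
   (fun h : R => h^-1 *: ((rho \o shift (x + t *: v)) (h *: v)
     - rho (x + t *: v))).
  apply/funext => h /=; congr (_ *: (rho _ - _)).
  by rewrite scalerDl scaler1 addrCA.
apply: DeriveDef.
  by rewrite /derivable E; exact: diff_derivable.
by rewrite /derive E.
Qed.

(** Applied at the zeros of a density, this makes the L1 norm of its derivative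
    an integral over the set where the density is positive, as in the
    definition of the Fisher information. *)
Lemma derive_at_min v x : (forall y, rho x <= rho y) -> 'D_v rho x = 0.
Proof.
move=> rx; have D := is_derive_along x v 0.
rewrite scale0r addr0 in D.
have D0 : is_derive (0 : R) (1 : R) (fun s : R => rho (x + s *: v)) 0.
  apply: (@derive1_at_min _ _ (-1) 1) => //.
  - by move=> t _; have [] := is_derive_along x v t.
  - by rewrite in_itv/=; lra.
  - by move=> t _; rewrite scale0r addr0.
by rewrite -(derive_val (is_derive := D)) (derive_val (is_derive := D0)).
Qed.

Lemma dot_score x v : 0 < rho x -> dot (score rho x) v = 'D_v rho x / rho x.
Proof.
move=> r0.
have dln : is_derive (rho x) 1 (@ln R) (rho x)^-1 by exact: is_derive1_ln.
have dl : differentiable (@ln R) (rho x).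
  by apply/derivable1_diffP; case: dln.
have Dln w : 'D_w (fun y => ln (rho y)) x = 'D_w rho x / rho x.
  rewrite deriveE; last exact: differentiable_comp.
  rewrite (diff_comp (drho x) dl)/= deriveE// deriv1E; last by case: dln.
  by rewrite derive1E derive_val.
rewrite /dot /score mxE.
under eq_bigr do rewrite !mxE Dln.
rewrite deriveE// [in RHS](row_sum_delta v) linear_sum mulr_suml.
apply: eq_bigr => i _; rewrite linearZ/= deriveE//.
rewrite /GRing.scale/=; ring.
Qed.

Hypothesis cD : forall v, continuous ('D_v rho).

Lemma increment_le_integral x u : (`|rho (x + u) - rho x|%:E <=
  \int[lebesgue_measure]_(t in `[0%R, 1%R]) `|'D_u rho (x + t *: u)|%:E)%E.
Proof.
pose g t := rho (x + t *: u); pose g' t := 'D_u rho (x + t *: u).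
have cline : continuous (fun t : R => x + t *: u).
  move=> t; apply: cvgD; first exact: cvg_cst.
  exact: scalel_continuous.
have cg' : continuous g'.
  move=> t; apply: (@continuous_comp _ _ _ (fun t : R => x + t *: u) ('D_u rho)).
    exact: cline.
  exact: cD.
have cg : continuous g.
  move=> t; apply: (@continuous_comp _ _ _ (fun t : R => x + t *: u) rho).
    exact: cline.
  exact: differentiable_continuous.
have FTC : (\int[lebesgue_measure]_(t in `[0%R, 1%R]) (g' t)%:E =
    (g 1)%:E - (g 0)%:E)%E.
  apply: continuous_FTC2 => //.
  - exact: continuous_subspaceT.
  - split.
    + by move=> t _; have [] := is_derive_along x u t.
    + by apply: cvg_at_right_filter; exact: cg.
    + by apply: cvg_at_left_filter; exact: cg.
  - move=> t _; rewrite derive1E.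
    by have D := is_derive_along x u t; rewrite derive_val.
have -> : `|rho (x + u) - rho x|%:E = (`|(g 1)%:E - (g 0)%:E|)%E.
  by rewrite /g scale1r scale0r addr0.
rewrite -FTC; apply: le_trans (le_abse_integral _ _ _) _ => //.
apply/measurable_EFinP; apply: measurable_funS (measurableT) _ _ => //.
exact: continuous_measurable_fun.
Qed.

(** Integrate [increment_le_integral] in x and exchange the integrals: for each
    t the inner integral over x does not depend on t, by translation
    invariance. *)
Lemma L1_increment_le u :
  (\int[lebesgue_rV d]_x `|rho (x + u) - rho x|%:E <=
   \int[lebesgue_rV d]_x `|'D_u rho x|%:E)%E.
Proof.
pose I : set R := `[0%R, 1%R]%classic.
pose ind : R -> R := \1_I.
(* The segment is put in the integrand: Tonelli is about full product spaces. *)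
pose F (p : 'rV[R]_d * R) := ((ind p.2 * `|'D_u rho (p.1 + p.2 *: u)|)%:E).
have mD : measurable_fun setT ('D_u rho) by exact: continuous_measurable_rV.
have mr : measurable_fun setT rho.
  by apply: continuous_measurable_rV => x; exact: differentiable_continuous.
have mI : measurable_fun [set: R] ind.
  by apply: measurable_indic; exact: measurable_itv.
have mF : measurable_fun setT F.
  apply/measurable_EFinP; apply: measurable_funM.
    exact: (measurableT_comp mI measurable_snd).
  apply: measurableT_comp => //; apply: (measurableT_comp mD).
  apply: measurable_fun_rV => i; under eq_fun do rewrite !mxE.
  apply: measurable_funD.
    by apply: (measurableT_comp (measurable_rV_coord i)); exact: measurable_fst.
  by apply: measurable_funM.
have F0 p : (0 <= F p)%E by rewrite lee_fin mulr_ge0.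
apply: (@le_trans _ _ (\int[lebesgue_rV d]_x \int[lebesgue_measure]_t F (x, t))%E).
  apply: ge0_le_integral => //.
  - apply/measurable_EFinP; apply: measurableT_comp => //.
    apply: measurable_funB; last exact: mr.
    exact: (measurableT_comp mr (measurable_rV_addr u)).
  - exact: measurable_fun_fubini_tonelli_F.
  - move=> x _; apply: le_trans (increment_le_integral x u) _.
    rewrite integral_mkcond le_eqVlt; apply/orP; left; apply/eqP.
    apply: eq_integral => t _.
    by rewrite patchE /F /ind indicE /=; case: ifP => _; rewrite ?mul1r ?mul0r.
rewrite fubini_tonelli//.
have mT t : measurable_fun setT (fun x : 'rV[R]_d => `|'D_u rho (x + t *: u)|%:E).
  apply/measurable_EFinP; apply: measurableT_comp => //.
  by apply: (measurableT_comp mD); exact: measurable_rV_addr.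
set C := (leRHS).
have C0 : (0 <= C)%E by exact: integral_ge0.
have mabs : measurable_fun setT (fun x => `|'D_u rho x|%:E).
  by apply/measurable_EFinP; apply: measurableT_comp.
have inv (t : R) : (\int[lebesgue_rV d]_x `|'D_u rho (x + t *: u)|%:E = C)%E.
  exact: (preserves_integral (preserves_lebesgue_rV (t *: u)) mabs).
rewrite [leLHS](_ : _ = \int[lebesgue_measure]_t ((ind t)%:E * C))%E; last first.
  apply: eq_integral => t _; rewrite /F/=.
  under eq_integral do rewrite EFinM.
  rewrite (ge0_integralZl (lebesgue_rV d) measurableT (mT t)); last 2 first.
    by move=> x _; rewrite lee_fin.
    by rewrite lee_fin.
  by rewrite inv.
have mind : measurable_fun setT (fun t => (ind t)%:E) by exact/measurable_EFinP.
rewrite (ge0_integralZr lebesgue_measure measurableT mind)//; last first.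
  by move=> t _; rewrite lee_fin.
rewrite [X in (X * _)%E](_ : _ = 1%E) ?mul1e//.
rewrite integral_indic//; last exact: measurable_itv.
rewrite setIT; have := @lebesgue_measure_itv R `[0, 1].
by rewrite /= lte_fin ltr01 oppr0 adde0.
Qed.

Hypothesis rho_ge0 : forall x, 0 <= rho x.
Hypothesis rho_int : (\int[lebesgue_rV d]_x (rho x)%:E = 1)%E.

Let mrho : measurable_fun setT rho.
Proof.
by apply: continuous_measurable_rV => x; exact: differentiable_continuous.
Qed.

Lemma L1_derive_le_fisher u :
  (\int[lebesgue_rV d]_x `|'D_u rho x|%:E <= sqrte (fisher rho u))%E.
Proof.
have mD : measurable_fun setT ('D_u rho) by exact: continuous_measurable_rV.
have mP : measurable [set x | 0 < rho x].
  rewrite (_ : [set x | 0 < rho x] = rho @^-1` `]0, +oo[%classic).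
    by rewrite -[X in measurable X]setTI; apply: mrho.
  by apply/seteqP; split => x /=; rewrite in_itv/= andbT.
pose a x := 'D_u rho x / rho x.
have ma : measurable_fun [set x | 0 < rho x] a.
  apply: (@measurable_funS _ _ _ _ setT) => //; apply: measurable_funM => //.
  rewrite (_ : (fun x => (rho x)^-1) = (fun x => rho x `^ (-1))).
    exact: (measurableT_comp (measurable_powR (-1)) mrho).
  by apply/funext => x; rewrite powR_inv1.
have -> : fisher rho u = (\int[lebesgue_rV d]_(x in [set x | (0 < rho x)%R])
    (a x ^+ 2 * rho x)%:E)%E.
  by apply: eq_integral => x; rewrite inE /= => x0; rewrite dot_score.
apply: le_trans (cauchy_schwarz_weight mP ma _ _ _).
- rewrite [leRHS]integral_mkcond le_eqVlt; apply/orP; left; apply/eqP.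
  apply: eq_integral => x _; rewrite patchE; case: ifPn => [|/negP].
    rewrite inE/= => x0; congr (_%:E).
    by rewrite /a normrM normfV (ger0_norm (rho_ge0 x)) divfK// gt_eqF.
  rewrite inE/= => /negP; rewrite -leNgt => rx0.
  have r0 : rho x = 0 by apply/eqP; rewrite eq_le rx0 rho_ge0.
  by rewrite derive_at_min ?normr0// => y; rewrite r0.
- exact: measurable_funS mrho.
- by move=> x /= /ltW.
- rewrite -rho_int; apply: ge0_subset_integral => //.
    exact/measurable_EFinP.
  by move=> x _; rewrite lee_fin.
Qed.

Lemma L1_increment_le_fisher u :
  (\int[lebesgue_rV d]_x `|rho (x + u) - rho x|%:E <= sqrte (fisher rho u))%E.
Proof. exact: le_trans (L1_increment_le u) (L1_derive_le_fisher u). Qed.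

End fisher_bound.

(** * The walk inside a slice of the subgraph *)

Section slice_walk.
Context {R : realType} {d : nat}.
Variable rho : 'rV[R]_d -> R.
Local Notation state := ('rV[R]_d * R)%type.
Implicit Types (w : state) (u : 'rV[R]_d).

Definition subgraph : set state := [set w | 0 < w.2 < rho w.1].

Definition shift_state u w : state := (w.1 + u, w.2).

Lemma shift_stateK u w : shift_state u (shift_state (- u) w) = w.
Proof. by case: w => x h; rewrite /shift_state/= subrK. Qed.

Definition fits u w : bool := w.2 < rho (w.1 + u).

Definition move w u : state := if fits u w then shift_state u w else w.

(** A state is a pair of a position and a height; the height never changes. *)
Definition walk : state -> seq 'rV[R]_d -> state := foldl move.

Lemma move_subgraph w u : subgraph w -> subgraph (move w u).
Proof.
rewrite /subgraph /move /fits /= => /andP[w0 wr].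
by case: ifPn => /= h; rewrite w0 //= wr.
Qed.

Lemma walk_subgraph w l : subgraph w -> subgraph (walk w l).
Proof. by elim: l w => [//|u l IH] w Gw /=; apply: IH; exact: move_subgraph. Qed.

Hypothesis mrho : measurable_fun setT rho.

Local Notation mu := (lebesgue_rV d \x @lebesgue_measure R)%E.

Lemma measurable_shift_state u : measurable_fun setT (shift_state u).
Proof.
apply: measurable_fun_pair; last exact: measurable_snd.
exact: (measurableT_comp (measurable_rV_addr u) measurable_fst).
Qed.

Lemma preserves_shift_state u : preserves mu (shift_state u).
Proof.
have pid : preserves (@lebesgue_measure R) (fun h => h).
  by split; [exact: measurable_id|].
exact: (preserves_product (preserves_lebesgue_rV u) pid).
Qed.

Lemma measurable_fits u : measurable_fun setT (fits u).
Proof.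
rewrite /fits; apply: measurable_fun_ltr; first exact: measurable_snd.
apply: (measurableT_comp mrho).
exact: (measurableT_comp (measurable_rV_addr u) measurable_fst).
Qed.

Lemma measurable_misfit u : measurable [set w | ~~ fits u w].
Proof.
rewrite -[X in measurable X]setTI (_ : [set w | _] = fits u @^-1` [set false]).
  exact: measurable_fits.
by apply/seteqP; split => w /= => [/negbTE|->].
Qed.

Lemma measurable_move u : measurable_fun setT (move ^~ u).
Proof.
rewrite /move; apply: measurable_fun_ifT; first exact: measurable_fits.
  exact: measurable_shift_state.
exact: measurable_id.
Qed.

Lemma measurable_walk l : measurable_fun setT (walk ^~ l).
Proof.
elim: l => [|u l IH]; first exact: measurable_id.
exact: (measurableT_comp IH (measurable_move u)).
Qed.

Lemma measurable_subgraph : measurable subgraph.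
Proof.
have m1 : measurable_fun setT (fun w : state => 0 < w.2).
  by apply: measurable_fun_ltr => //; exact: measurable_snd.
have m2 : measurable_fun setT (fun w : state => w.2 < rho w.1).
  apply: measurable_fun_ltr; first exact: measurable_snd.
  exact: (measurableT_comp mrho measurable_fst).
rewrite (_ : subgraph =
    [set w : state | 0 < w.2] `&` [set w : state | w.2 < rho w.1]).
  apply: measurableI; rewrite -[X in measurable X]setTI.
    exact: (m1 measurableT [set true]).
  exact: (m2 measurableT [set true]).
by apply/seteqP; split => w; rewrite /subgraph /=; [move=> /andP[]|move=> [-> ->]].
Qed.

Lemma measurable_preimage_shift u A : measurable A ->
  measurable (shift_state u @^-1` A).
Proof.
by move=> mA; rewrite -[X in measurable X]setTI; exact: measurable_shift_state.
Qed.

Lemma move_preimage u A : move^~ u @^-1` A `&` subgraph =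
  (shift_state u @^-1` (A `&` subgraph) `&` subgraph) `|`
  ((A `&` subgraph) `\` shift_state u @^-1` subgraph).
Proof.
apply/seteqP; split => w; rewrite /move /fits /subgraph /shift_state /=.
  case: ifPn => h [Aw /andP[w0 wr]]; [left|right].
    by split; [split => //; rewrite w0|rewrite w0].
  by split; [split => //; rewrite w0|rewrite andbF].
case=> [[[Aw /andP[w0 wr]] /andP[_ wr']]|[[Aw /andP[w0 wr]] nw]].
  by rewrite wr w0 wr'.
by rewrite ifF ?w0 ?wr//; apply/negP => h; apply: nw; rewrite w0.
Qed.

(** The states that [move] brings into A are those whose translate is in A, and
    those of A that stay put. Translating the former back gives a set inside A,
    so both terms compare with the measure of A itself. *)
Lemma move_measure u A : measurable A ->
  mu (move^~ u @^-1` A `&` subgraph) =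
  (mu ((A `&` subgraph) `&` shift_state (- u)%R @^-1` subgraph) +
   mu ((A `&` subgraph) `\` shift_state u @^-1` subgraph))%E.
Proof.
move=> mA; have mG := measurable_subgraph.
have mAG : measurable (A `&` subgraph) by exact: measurableI.
rewrite move_preimage measureU; last 3 first.
- by apply: measurableI => //; exact: measurable_preimage_shift.
- by apply: measurableD => //; exact: measurable_preimage_shift.
- by apply/seteqP; split => // w [[[_ ?] _] [_]].
congr (_ + _)%E; rewrite -[LHS](preserves_shift_state (- u)).2; last first.
  by apply: measurableI => //; exact: measurable_preimage_shift.
by congr (mu _); apply/seteqP; split => w /=; rewrite shift_stateK => -[].
Qed.

(** A state of A is counted once by the step u if u can have led to it, and once
    by the step -u if -u is rejected there. These two conditions say that the
    translate by -u is in the subgraph and that it is not, so together they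
    count every state of A exactly once; likewise with u and -u exchanged. *)
Lemma move_stationary u A : measurable A ->
  (mu (move^~ u @^-1` A `&` subgraph) + mu (move^~ (- u)%R @^-1` A `&` subgraph) =
   mu (A `&` subgraph) + mu (A `&` subgraph))%E.
Proof.
move=> mA; have mG := measurable_subgraph.
rewrite !move_measure// opprK addeACA [X in (_ + X)%E]addeC addeACA.
have split_by t : (mu ((A `&` subgraph) `&` shift_state t @^-1` subgraph) +
   mu ((A `&` subgraph) `\` shift_state t @^-1` subgraph) = mu (A `&` subgraph))%E.
  rewrite addeC -measureDI//; first exact: measurableI.
  exact: measurable_preimage_shift.
rewrite -[X in _ = (X + _)%E](split_by (- u)) -[X in _ = (_ + X)%E](split_by u).
by rewrite addeACA [X in (_ + X)%E]addeC addeACA.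
Qed.

Hypothesis rho_ge0 : forall x, 0 <= rho x.

Lemma measure_subgraph : mu subgraph = (\int[lebesgue_rV d]_x (rho x)%:E)%E.
Proof.
apply: eq_integral => x _ /=.
rewrite (_ : xsection _ _ = `]0, rho x[%classic).
  rewrite lebesgue_measure_itv/= lte_fin oppr0 adde0; case: ifPn => //.
  by rewrite -leNgt => r0; congr (_%:E); apply/eqP; rewrite eq_le r0 rho_ge0.
by apply/seteqP; split => h; rewrite /xsection/= inE/= in_itv/=.
Qed.

(** Translating the second set by u turns the sum into the measure of the
    symmetric difference of the subgraph and its translate, whose section at x
    is the difference of the intervals ]0, rho x[ and ]0, rho (x + u)[. *)
Lemma rejection_measure u :
  (mu ([set w | ~~ fits u w] `&` subgraph) +
   mu ([set w | ~~ fits (- u)%R w] `&` subgraph) <=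
  \int[lebesgue_rV d]_x `|rho (x + u) - rho x|%:E)%E.
Proof.
have mG := measurable_subgraph.
have mF t : measurable ([set w | ~~ fits t w] `&` subgraph).
  by apply: measurableI => //; exact: measurable_misfit.
rewrite -[X in (_ + X)%E](preserves_shift_state u).2; last exact: mF.
have mFs : measurable
    (shift_state u @^-1` ([set w | ~~ fits (- u) w] `&` subgraph)).
  exact: measurable_preimage_shift.
have mX1 := measurable_fun_xsection (@lebesgue_measure R) (mF u).
have mX2 := measurable_fun_xsection (@lebesgue_measure R) mFs.
rewrite /product_measure1 -ge0_integralD//.
apply: ge0_le_integral => //.
- by move=> x _; rewrite adde_ge0.
- exact: (emeasurable_funD mX1 mX2).
- apply/measurable_EFinP; apply: measurableT_comp => //.
  apply: measurable_funB => //.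
  exact: (measurableT_comp mrho (measurable_rV_addr u)).
move=> x _ /=.
rewrite (_ : xsection _ _ = `]0, rho x[ `\` `]0, rho (x + u)[); last first.
  apply/seteqP; split => h; rewrite /xsection/= inE/= /subgraph /fits/= !in_itv/=.
    by move=> [/negbTE n1 /andP[-> ->]]; rewrite n1.
  by move=> [/andP[-> ->] /negP].
rewrite [X in (_ + lebesgue_measure X)%E]
  (_ : _ = `]0, rho (x + u)[ `\` `]0, rho x[); last first.
  apply/seteqP; split => h; rewrite /xsection/= inE/= /subgraph /fits/= !in_itv/= addrK.
    by move=> [/negbTE n1 /andP[-> ->]]; rewrite n1.
  by move=> [/andP[-> ->] /negP].
have itvD (a b : R) : 0 <= a -> a <= b ->
   (lebesgue_measure (`]0%R, a[ `\` `]0%R, b[) +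
    lebesgue_measure (`]0%R, b[ `\` `]0%R, a[) <= (b - a)%:E)%E.
  move=> a0 ab.
  rewrite (_ : `]0, a[ `\` `]0, b[ = set0); last first.
    apply/seteqP; split => // h /=; rewrite !in_itv/= => -[/andP[h0 ha]]; apply.
    by rewrite h0 (lt_le_trans ha).
  rewrite measure0 add0e.
  apply: (@le_trans _ _ (lebesgue_measure `[a, b[%classic)).
    apply: le_measure; rewrite ?inE//; first exact: measurableD.
    move=> h /=; rewrite !in_itv/= => -[/andP[h0 hb] /negP].
    by rewrite h0/= -leNgt => ->.
  by rewrite lebesgue_measure_itv/= lte_fin; case: ifPn => // _; rewrite lee_fin subr_ge0.
have [ab|ba] := leP (rho x) (rho (x + u)).
  by rewrite ger0_norm ?subr_ge0//; exact: itvD.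
rewrite ltr0_norm ?subr_lt0// opprB addeC.
by apply: itvD => //; exact: ltW.
Qed.

End slice_walk.

(** * Averaging over the signs *)

Section signs.
Context {R : realType}.

Definition flip n (j : 'I_n) (sigma : {ffun 'I_n -> bool}) :
    {ffun 'I_n -> bool} :=
  [ffun i => if i == j then ~~ sigma i else sigma i].

Lemma flipK n (j : 'I_n) : involutive (flip j).
Proof.
by move=> s; apply/ffunP => i; rewrite !ffunE; case: eqP => // _; rewrite negbK.
Qed.

(** This is how independence of the j-th sign from the earlier ones is used: F
    stands for a quantity that depends on the signs other than the j-th one, and
    on one further sign given as an argument. *)
Lemma sum_flip n (j : 'I_n) (F : {ffun 'I_n -> bool} -> bool -> \bar R) :
  (forall s b, F (flip j s) b = F s b) ->
  (\sum_s F s (s j) + \sum_s F s (s j) = \sum_s (F s true + F s false))%E.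
Proof.
move=> Ff; rewrite [X in (_ + X)%E](reindex_inj (inv_inj (flipK j))) -big_split/=.
apply: eq_bigr => s _; rewrite Ff ffunE eqxx.
by case: (s j) => //=; rewrite addeC.
Qed.

Lemma double_inje (x y : \bar R) : (x + x = y + y)%E -> x = y.
Proof.
case: x y => [x| |] [y| |] //=; rewrite -!EFinD => -[xy]; congr (_%:E); lra.
Qed.

Lemma double_lee (x y : \bar R) : (x + x <= y + y)%E -> (x <= y)%E.
Proof.
case: x y => [x| |] [y| |] //=; rewrite -?EFinD ?lee_fin => xy;
  rewrite ?leey ?leNye ?lee_fin//; lra.
Qed.

Definition sign (b : bool) : R := if b then 1 else -1.

Variables (d n : nat) (v : 'I_n -> 'rV[R]_d).
Implicit Type sigma : {ffun 'I_n -> bool}.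

Lemma take_steps (s : 'I_n -> R) (j : 'I_n) :
  take j.+1 (steps v s) = rcons (take j (steps v s)) (s j *: v j).
Proof.
have sz : size (steps v s) = n by rewrite size_map size_enum_ord.
rewrite (take_nth 0) ?sz//; congr (rcons _ _).
by rewrite (nth_map j) ?size_enum_ord// nth_ord_enum.
Qed.

Lemma eq_take_steps (s s' : 'I_n -> R) k :
  (forall i : 'I_n, (i < k)%N -> s i = s' i) ->
  take k (steps v s) = take k (steps v s').
Proof.
move=> ss'.
have E (t : 'I_n -> R) :
    take k (steps v t) = [seq t i *: v i | i <- take k (enum 'I_n)].
  exact/esym/map_take.
rewrite !E; apply/eq_in_map => i /(map_f val).
rewrite map_take val_enum_ord take_iota mem_iota/= add0n leq_min => /andP[ik _].
by rewrite (ss' _ ik).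
Qed.

Definition sign_steps sigma := steps v (fun i => sign (sigma i)).

Lemma take_sign_steps_flip (j : 'I_n) sigma :
  take j (sign_steps (flip j sigma)) = take j (sign_steps sigma).
Proof.
by apply: eq_take_steps => i ij; rewrite ffunE ifN// -val_eqE/= ltn_eqF.
Qed.

End signs.

(** In this section P stands for the law of the seed, of which it retains the
    conclusion of [move_stationary]. *)
Section stationary_walk.
Context {R : realType} {d n : nat}.
Variables (rho : 'rV[R]_d -> R) (v : 'I_n -> 'rV[R]_d).
Hypothesis mrho : measurable_fun setT rho.
Variable P : set ('rV[R]_d * R) -> \bar R.
Hypothesis P_ge0 : forall A, (0 <= P A)%E.
Hypothesis P_stationary : forall u A, measurable A ->
  (P ((move rho)^~ u @^-1` A) + P ((move rho)^~ (- u)%R @^-1` A) = P A + P A)%E.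

(** By induction on k: the set of states from which the next step leads to A
    depends on the sign of that step only, so the induction hypothesis replaces
    its preimage by the walk by the set itself, for either sign; then
    stationarity for the two opposite steps applies. *)
Lemma walk_stationary k A : (k <= n)%N -> measurable A ->
  (\sum_(sigma : {ffun 'I_n -> bool})
     P ((walk rho)^~ (take k (sign_steps v sigma)) @^-1` A) =
   \sum_(sigma : {ffun 'I_n -> bool}) P A)%E.
Proof.
elim: k A => [|k IH] A kn mA.
  by apply: eq_bigr => sigma _; rewrite take0.
pose j := Ordinal kn.
pose F (sigma : {ffun 'I_n -> bool}) b := P
  ((walk rho)^~ (take j (sign_steps v sigma)) @^-1`
     ((move rho)^~ (sign b *: v j) @^-1` A)).
have mm u : measurable ((move rho)^~ u @^-1` A).
  by rewrite -[X in measurable X]setTI; exact: measurable_move.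
have FE b : (\sum_sigma F sigma b = \sum_(sigma : {ffun 'I_n -> bool})
    P ((move rho)^~ (sign b *: v j) @^-1` A))%E.
  exact: IH (ltnW kn) (mm _).
apply: double_inje.
rewrite (eq_bigr (fun sigma => F sigma (sigma j))); last first.
  move=> sigma _; rewrite /F; congr (P _); apply/seteqP.
  by split => w /=; rewrite /sign_steps (take_steps v _ j) /walk foldl_rcons.
rewrite sum_flip; last by move=> sigma b; rewrite /F take_sign_steps_flip.
rewrite big_split/= !FE -!big_split/=.
apply: eq_bigr => _ _; rewrite scale1r scaleN1r.
exact: P_stationary.
Qed.

Lemma mean_rejection_le (j : 'I_n) (L : \bar R) : (0 <= L)%E ->
  (P [set w | ~~ fits rho (v j) w] + P [set w | ~~ fits rho (- v j)%R w] <= L)%E ->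
  (\sum_(sigma : {ffun 'I_n -> bool}) (2^-1 ^+ n)%:E * P
     ((walk rho)^~ (take j (sign_steps v sigma)) @^-1`
       [set w | ~~ fits rho (sign (sigma j) *: v j) w]) <= (2^-1)%:E * L)%E.
Proof.
move=> L0 PL.
pose F (sigma : {ffun 'I_n -> bool}) b := P
  ((walk rho)^~ (take j (sign_steps v sigma)) @^-1`
     [set w | ~~ fits rho (sign b *: v j) w]).
have FE b : (\sum_sigma F sigma b = \sum_(sigma : {ffun 'I_n -> bool})
    P [set w | ~~ fits rho (sign b *: v j) w])%E.
  by apply: walk_stationary; [exact: ltnW|exact: measurable_misfit].
rewrite (eq_bigr (fun sigma => (2^-1 ^+ n)%:E * F sigma (sigma j))%E)//.
rewrite -ge0_sume_distrr//; last by move=> *; exact: P_ge0.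
have S2 : (\sum_sigma F sigma (sigma j) + \sum_sigma F sigma (sigma j) <=
    (2 ^+ n)%:E * L)%E.
  rewrite sum_flip; last by move=> sigma b; rewrite /F take_sign_steps_flip.
  rewrite big_split/= !FE -big_split/= scale1r scaleN1r.
  apply: (@le_trans _ _ (\sum_(sigma : {ffun 'I_n -> bool}) L)%E).
    exact: lee_sum.
  rewrite (eq_bigr (fun=> 1%:E * L)%E); last by move=> *; rewrite mul1e.
  rewrite -ge0_sume_distrl; last by move=> *; exact: lee01.
  by rewrite sumEFin sumr_const card_ffun card_bool card_ord natrX.
have S0 : (0 <= \sum_sigma F sigma (sigma j))%E.
  by apply: sume_ge0 => *; exact: P_ge0.
apply: double_lee.
rewrite -ge0_muleDr// -ge0_muleDl// ?lee_fin// -EFinD.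
rewrite (_ : 2^-1 + 2^-1 = 1 :> R); last by field.
rewrite mul1e; apply: le_trans (lee_wpmul2l _ S2) _; first by rewrite lee_fin exprn_ge0.
by rewrite muleA -EFinM -exprMn mulVf// expr1n mul1e.
Qed.

End stationary_walk.

(** * The expected number of discarded steps *)

(** The integral of a nonnegative function is a supremum over the simple
    functions below it, hence monotone without any measurability. This spares
    the joint measurability, in the signs and the seed, of the number of
    discarded steps. *)
Lemma ge0_le_integral_lower {R : realType} (disp : measure_display)
    (T : measurableType disp) (mu : {measure set T -> \bar R})
    (f g : T -> \bar R) :
  (forall x, 0 <= f x)%E -> (forall x, f x <= g x)%E ->
  (\int[mu]_x f x <= \int[mu]_x g x)%E.
Proof.
move=> f0 fg; have g0 x : (0 <= g x)%E by exact: le_trans (f0 x) (fg x).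
rewrite !ge0_integralE// ge_ereal_sup// => _ [h /= hf <-].
apply: le_ereal_sup_tmp; eexists; last exact: lexx; exists h => //= x.
by apply: le_trans (hf x) _; rewrite !patch_setT.
Qed.

Section expected_discards.
Context {R : realType} {d n : nat}.
Variables (v : 'I_n -> 'rV[R]_d) (disp : measure_display)
  (Omega : measurableType disp) (P : probability Omega R)
  (eps : 'I_n -> {RV P >-> R}).
Hypothesis eps_rademacher : forall j, rademacher (eps j).
Hypothesis eps_independent : mutually_independent eps.
Implicit Type sigma : {ffun 'I_n -> bool}.

Definition sign_pattern sigma : set Omega :=
  [set w | forall j, eps j w = sign (sigma j)].

Lemma sign_patternE sigma : sign_pattern sigma =
  \bigcap_(j in [set` [set: 'I_n]%SET]) (eps j @^-1` [set sign (sigma j)]).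
Proof.
apply/seteqP; split => [w pw j _|w pw j]; first exact: pw.
by apply: pw; rewrite /= inE.
Qed.

Lemma measurable_sign_pattern sigma : measurable (sign_pattern sigma).
Proof.
by rewrite sign_patternE; exact: fin_bigcap_measurable.
Qed.

Lemma sign_pattern_probability sigma :
  P (sign_pattern sigma) = (2^-1 ^+ n)%:E.
Proof.
rewrite sign_patternE eps_independent//.
rewrite (eq_bigr (fun=> (2^-1)%:E)); last first.
  by move=> j _; have [] := eps_rademacher j; rewrite /sign; case: (sigma j).
by rewrite prodEFin prodr_const cardsT card_ord.
Qed.

(** The random signs take other values than 1 and -1 on a null set only, but
    there the algorithm may do anything. *)
Definition no_sign_pattern : set Omega := ~` \bigcup_sigma sign_pattern sigma.

Lemma measurable_no_sign_pattern : measurable no_sign_pattern.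
Proof.
apply: measurableC; apply: fin_bigcup_measurable => // sigma _.
exact: measurable_sign_pattern.
Qed.

Lemma no_sign_pattern_null : P no_sign_pattern = 0%E.
Proof.
rewrite probability_setC; last first.
  by apply: fin_bigcup_measurable => // sigma _; exact: measurable_sign_pattern.
rewrite measure_fin_bigcup//; last 3 first.
- exact: finite_finset.
- move=> s t _ _ [w [ws wt]]; apply/ffunP => j.
  have : sign (s j) = sign (t j) :> R by rewrite -ws wt.
  by rewrite /sign; case: (s j); case: (t j) => // ?; exfalso; lra.
- by move=> sigma _; exact: measurable_sign_pattern.
rewrite (_ : setT = [set` index_enum {ffun 'I_n -> bool}]); last first.
  by apply/seteqP; split => // s _ /=; rewrite mem_index_enum.
rewrite -fsbig_seq ?index_enum_uniq//.
rewrite (eq_bigr _ (fun s _ => sign_pattern_probability s)) sumEFin sumr_const.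
rewrite card_ffun card_bool card_ord -[_ *+ _]mulr_natl natrX.
by rewrite -exprMn mulfV// expr1n -EFinB subrr.
Qed.

Variable A : online_algorithm R d.

Definition discard_event sigma j : set (seed A) :=
  [set w | ~~ accepts v w (fun i => sign (sigma i)) j].

Lemma measurable_discard_event sigma j : measurable (discard_event sigma j).
Proof.
rewrite (_ : discard_event sigma j =
    ~` [set w : seed A | accepts v w (fun i => sign (sigma i)) j]).
  by apply: measurableC; exact: measurable_decide.
by apply/seteqP; split => w /= /negP.
Qed.

Lemma num_discardedE w (s : 'I_n -> R) :
  (num_discarded v w s)%:R = \sum_(j < n) (~~ accepts (A := A) v w s j)%:R :> R.
Proof.
rewrite /num_discarded -sum1_card natr_sum big_mkcond/=; apply: eq_bigr => j _.
by rewrite inE; case: (accepts _ _ _ _).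
Qed.

(** The sign patterns and the exceptional set partition the sample space. On
    each pattern the number of discarded steps is a function of the seed; on the
    exceptional set it is at most n. *)
Lemma expected_discards_le :
  ('E_(P \x seed_law A)
      [fun w => (num_discarded v w.2 (fun j => eps j w.1))%:R] <=
   \sum_(j < n) \sum_sigma
     (2^-1 ^+ n)%:E * seed_law A (discard_event sigma j))%E.
Proof.
rewrite unlock.
pose B sigma j := sign_pattern sigma `*` discard_event sigma j.
pose N := no_sign_pattern `*` [set: seed A].
have mB sigma j : measurable (B sigma j).
  apply: measurableX; first exact: measurable_sign_pattern.
  exact: measurable_discard_event.
have mN : measurable N.
  by apply: measurableX => //; exact: measurable_no_sign_pattern.
have mind (E : set (Omega * seed A)) :
    measurable E -> measurable_fun setT (fun z => (\1_E z : R)%:E).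
  by move=> mE; apply/measurable_EFinP; exact: measurable_indic.
have intX (E : set Omega) (F : set (seed A)) : measurable E -> measurable F ->
    (\int[P \x seed_law A]_z (\1_(E `*` F) z : R)%:E = P E * seed_law A F)%E.
  move=> mE mF; rewrite integral_indic//; last exact: measurableX.
  by rewrite setIT; exact: product_measure1E.
pose g z := (\sum_(j < n) \sum_sigma (\1_(B sigma j) z : R)%:E +
  n%:R%:E * (\1_N z : R)%:E)%E.
apply: (@le_trans _ _ (\int[P \x seed_law A]_z g z)%E).
  apply: ge0_le_integral_lower => -[om w]; first by rewrite lee_fin.
  rewrite /g /=.
  have S0 : (0 <= \sum_(j < n) \sum_sigma (\1_(B sigma j) (om, w) : R)%:E)%E.
    by apply: sume_ge0 => j _; apply: sume_ge0 => s _; rewrite lee_fin.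
  have [[s _ oms]|nom] := pselect ((\bigcup_sigma sign_pattern sigma) om).
    rewrite -[leLHS]adde0; apply: leeD; last by rewrite mule_ge0 ?lee_fin.
    have -> : (fun j => eps j om) = (fun j => sign (s j)) by exact/funext.
    rewrite num_discardedE -sumEFin; apply: lee_sum => j _.
    rewrite (bigD1 s)//= -[leLHS]adde0; apply: leeD; last first.
      by apply: sume_ge0 => t _; rewrite lee_fin.
    rewrite indicE lee_fin; case: (boolP (accepts _ _ _ _)) => // rej.
    by rewrite mem_set//.
  rewrite -[leLHS]add0e; apply: leeD => //.
  rewrite indicE mem_set// mule1 lee_fin ler_nat.
  by rewrite -[leqRHS](card_ord n); exact: max_card.
rewrite /g ge0_integralD//; last 3 first.
- by move=> z _; apply: sume_ge0 => j _; apply: sume_ge0 => s _; rewrite lee_fin.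
- by apply: emeasurable_sum => j; apply: emeasurable_sum => s; exact: mind.
- by apply: measurable_funeM; exact: mind.
rewrite [X in (_ + X)%E](_ : _ = 0%E); last first.
  rewrite ge0_integralZl//; last exact: mind.
  rewrite intX//; last exact: measurable_no_sign_pattern.
  by rewrite no_sign_pattern_null mul0e mule0.
rewrite adde0 ge0_integral_sum//; last 2 first.
- by move=> j; apply: emeasurable_sum => s; exact: mind.
- by move=> j z _; apply: sume_ge0 => s _; rewrite lee_fin.
apply: lee_sum => j _; rewrite ge0_integral_sum//; last by move=> s; exact: mind.
apply: lee_sum => s _.
rewrite intX ?sign_pattern_probability//.
- exact: measurable_sign_pattern.
- exact: measurable_discard_event.
Qed.

End expected_discards.

(** * The algorithm *)

Lemma sub_convex_symmetric {R : realType} {d : nat} (K : set 'rV[R]_d) x y :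
  convex_set (K : set (convex_lmodType 'rV[R]_d)) -> [set - z | z in K] = K ->
  K x -> K y -> [set 2 *: z | z in K] (x - y).
Proof.
move=> cK sK Kx Ky; exists (2^-1 *: (x - y)); last first.
  by rewrite scalerA mulfV// scale1r.
have Ky' : K (- y) by rewrite -sK; exists y.
have h0 : 0 <= 2^-1 :> R by rewrite invr_ge0.
have h1 : 2^-1 <= 1 :> R by lra.
have := cK x (- y) (Itv01 h0 h1); rewrite !inE => /(_ Kx Ky').
congr (K _); rewrite scalerBr /conv/=.
rewrite -scalerN; congr (_ + _ *: _) => /=.
by rewrite /unstable.onem; field.
Qed.

Section walk_path.
Context {R : realType} {d n : nat}.
Variables (rho : 'rV[R]_d -> R) (v : 'I_n -> 'rV[R]_d) (s : 'I_n -> R).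

(** The sum of accepted steps, which has to be in 2K, is thus the difference of
    two positions of the walk. *)
Lemma walk_displacement w k : (k <= n)%N ->
  (walk rho w (take k (steps v s))).1 = w.1 +
  \sum_(j < n | (j < k)%N &&
      fits rho (s j *: v j) (walk rho w (take j (steps v s)))) s j *: v j.
Proof.
elim: k => [|k IH] kn.
  by rewrite take0 big_pred0 ?addr0// => j; rewrite ltn0.
pose j := Ordinal kn.
rewrite (take_steps v s j) /walk foldl_rcons -!/(walk _ _ _).
rewrite big_mkcondr/= (bigD1 j)//=
  [X in _ + (_ + X)](eq_bigl (fun i : 'I_n => (i < k)%N)).
  rewrite -big_mkcondr/= addrCA -IH ?(ltnW kn)// /move.
  by case: ifPn => _ /=; rewrite ?add0r// addrC.
by move=> i; rewrite -val_eqE/= ltnS leq_eqVlt; case: ltngtP.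
Qed.

End walk_path.

Section slice_law.
Context {R : realType} {d : nat}.
Variable rho : 'rV[R]_d -> R.
Hypothesis mrho : measurable_fun setT rho.
Hypothesis rho_density : probability_density rho.

Definition slice :=
  mrestr (lebesgue_rV d \x @lebesgue_measure R)%E (measurable_subgraph mrho).

HB.instance Definition _ := Measure.on slice.

Let slice_setT : slice setT = 1%E.
Proof.
rewrite /slice /mrestr setTI measure_subgraph ?rho_density.2//.
exact: rho_density.1.
Qed.

HB.instance Definition _ := Measure_isProbability.Build _ _ _ slice slice_setT.

Definition slice_law : probability _ R := slice.

End slice_law.

Section slice_algorithm.
Context {R : realType} {d : nat}.
Variable rho : 'rV[R]_d -> R.
Hypothesis mrho : measurable_fun setT rho.
Hypothesis rho_density : probability_density rho.

(** The walk is recomputed from all the steps but the last, which is the one to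
    be decided. The seeds outside the subgraph have probability 0 but must still
    obey the constraint; they discard every step. *)
Definition slice_decide (w : 'rV[R]_d * R) (obs : seq 'rV[R]_d) : bool :=
  (0 < w.2 < rho w.1) &&
  fits rho (last 0 obs) (walk rho w (take (size obs).-1 obs)).

Lemma slice_decide_rcons w l u :
  slice_decide w (rcons l u) = (0 < w.2 < rho w.1) && fits rho u (walk rho w l).
Proof.
by rewrite /slice_decide last_rcons size_rcons/= -cats1 take_size_cat.
Qed.

Lemma measurable_slice_decide obs : measurable [set w | slice_decide w obs].
Proof.
rewrite (_ : [set w | _] = subgraph rho `&`
    (walk rho)^~ (take (size obs).-1 obs) @^-1`
      (fits rho (last 0 obs) @^-1` [set true])).
  apply: measurableI; first exact: measurable_subgraph.
  rewrite -[X in measurable X]setTI; apply: measurable_walk => //.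
  by rewrite -[X in measurable X]setTI; exact: measurable_fits.
by apply/seteqP; split => w /=; rewrite /slice_decide => /andP.
Qed.

Definition slice_algorithm : online_algorithm R d :=
  OnlineAlgorithm (slice_law mrho rho_density) measurable_slice_decide.

Lemma accepts_slice n (v : 'I_n -> 'rV[R]_d) (w : seed slice_algorithm) s j :
  accepts v w s j = (0 < w.2 < rho w.1) &&
    fits rho (s j *: v j) (walk rho w (take j (steps v s))).
Proof. by rewrite /accepts take_steps /= slice_decide_rcons. Qed.

End slice_algorithm.

Theorem theorem1p1 (R : realType) (d n : nat) (K : set 'rV[R]_d)
    (v : 'I_n -> 'rV[R]_d) (rho : 'rV[R]_d -> R)
    (disp : measure_display) (Omega : measurableType disp)
    (P : probability Omega R) (eps : 'I_n -> {RV P >-> R})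
    (K_convex : convex_set (K : set (convex_lmodType 'rV[R]_d)))
    (K_symmetric : [set - x | x in K] = K)
    (K_interior : K° !=set0)
    (eps_rademacher : forall j, rademacher (eps j))
    (eps_independent : mutually_independent eps)
    (rho_density : probability_density rho)
    (rho_smooth : smooth rho)
    (rho_support : closed_support rho `<=` K°) :
  exists A : online_algorithm R d,
    (forall (w : seed A) (s : 'I_n -> R), (forall j, s j = 1 \/ s j = -1) ->
      forall k : 'I_n,
        [set 2 *: x | x in K]
          (\sum_(j < n | (j <= k)%N && accepts v w s j) s j *: v j)) /\
    ('E_(P \x seed_law A)
        [fun w => (num_discarded v w.2 (fun j => eps j w.1))%:R]
      <= (2^-1)%:E * \sum_(j < n) sqrte (fisher rho (v j)))%E.
Proof.
have drho x : differentiable rho x by exact: (rho_smooth [::]).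
have cD u : continuous ('D_u rho).
  by move=> x; apply: differentiable_continuous; exact: (rho_smooth [:: u]).
have mrho : measurable_fun setT rho.
  by apply: continuous_measurable_rV => x; exact: differentiable_continuous.
have rhoK x : 0 < rho x -> K x.
  move=> rx; apply: interior_subset; apply: rho_support.
  by apply: subset_closure; rewrite /= gt_eqF.
exists (slice_algorithm mrho rho_density); split.
  move=> w s _ k.
  have [wG|wG] := boolP (0 < w.2 < rho w.1); last first.
    rewrite big_pred0; last by move=> j; rewrite accepts_slice (negbTE wG) andbF.
    have [x /interior_subset Kx] := K_interior.
    by rewrite -(subrr x); exact: sub_convex_symmetric.
  have := walk_displacement rho v s w (ltn_ord k).
  rewrite (eq_bigl (fun j : 'I_n => (j <= k)%N && accepts v w s j)); last first.
    by move=> j; rewrite accepts_slice wG ltnS.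
  move/(congr1 (fun z => z - w.1)); rewrite [w.1 + _]addrC addrK => <-.
  have GK z : subgraph rho z -> K z.1.
    by move=> /andP[h0 hz]; apply: rhoK; exact: lt_trans hz.
  by apply: sub_convex_symmetric => //; apply: GK => //; exact: walk_subgraph.
apply: le_trans (expected_discards_le v eps_rademacher eps_independent _) _.
rewrite ge0_sume_distrr//; last by move=> j _; exact: sqrte_ge0.
apply: lee_sum => j _.
apply: le_trans; last first.
  apply: lee_wpmul2l; first by rewrite lee_fin.
  exact: (L1_increment_le_fisher drho cD rho_density.1 rho_density.2).
have P0 X : (0 <= slice_law mrho rho_density X)%E by exact: measure_ge0.
have Pst u X : measurable X ->
   (slice_law mrho rho_density ((move rho)^~ u @^-1` X) +
    slice_law mrho rho_density ((move rho)^~ (- u)%R @^-1` X) =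
    slice_law mrho rho_density X + slice_law mrho rho_density X)%E.
  exact: move_stationary.
apply: le_trans (mean_rejection_le (v := v) mrho P0 Pst _ _); last 2 first.
  exact: integral_ge0.
  exact: (rejection_measure mrho rho_density.1).
apply: lee_sum => sigma _; apply: lee_wpmul2l; first by rewrite lee_fin exprn_ge0.
(* The law of the seed only sees the subgraph, where rejection is misfit. *)
rewrite le_eqVlt; apply/orP; left; apply/eqP.
rewrite /slice_law /= /slice /mrestr; congr (_ _).
apply/seteqP; split => w;
  by rewrite /discard_event/= take_steps slice_decide_rcons => -[rej wG];
  move: rej; rewrite wG.
Qed.
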